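(* Let $\alpha\in\mathbb{C}$ with $|\alpha|=1$, let $D$ be an $\alpha$-monograph of first kind, and let $U$ be a connected subgraph of $D$ all of whose edges are digons. Let $M$ be a finite set of new vertices and, for each $x\in M$, let $V_x\subseteq V(U)$. Form $\tilde D$ from $D$ by adding the vertices of $M$ and, for each $x\in M$, joining $x$ by arcs to exactly the vertices of $V_x$, either all directed out of $x$ (so $N^+_{\tilde D}(x)=V_x$) or all directed into $x$ (so $N^-_{\tilde D}(x)=V_x$), with no other edges at $x$. Then $\tilde D$ is an $\alpha$-monograph of first kind.
   Context: A mixed graph $D$ is obtained from a finite simple undirected graph $\Gamma(D)$ by replacing some edges by arcs: between any two adjacent vertices $u,v$ there is exactly one of a digon $u\sim v$, an arc $u\to v$, or an arc $v\to u$. $N^+(x)$ (resp. $N^-(x)$) is the set of vertices $v$ with an arc $x\to v$ (resp. $v\to x$). For $|\alpha|=1$ set $h_{uv}=1$ if $u\sim v$, $\alpha$ if $u\to v$, $\bar\alpha$ if $v\to u$. A mixed walk $W=v_1,\dots,v_k$ (consecutive vertices adjacent in $\Gamma(D)$) has value $h_\alpha(W)=h_{v_1v_2}\cdots h_{v_{k-1}v_k}$. For a cycle $C$ of $\Gamma(D)$ with vertices $v_1,\dots,v_\ell$ in cyclic order, a traversal $\vec C$ is the closed walk $v_1,\dots,v_\ell,v_1$ (either direction, any start). A mixed graph is an $\alpha$-monograph of first kind if $h_\alpha(\vec C)=1$ for every cycle $C$ and every traversal $\vec C$. *)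

(* Defs.v *)
From mathcomp Require Import all_boot all_order all_algebra.
From mathcomp Require Import reals.
From mathcomp Require Import complex.

Set Implicit Arguments.
Unset Strict Implicit.
Unset Printing Implicit Defensive.

Import GRing.Theory Num.Theory.
Local Open Scope ring_scope.

(* The axioms say that two adjacent vertices are linked by exactly one of
   a digon, an arc one way, or an arc the other way. *)
Record mixed_graph (V : finType) := MixedGraph {
  mg_digon : rel V;
  mg_arc : rel V;
  digon_sym : symmetric mg_digon;
  digon_irr : irreflexive mg_digon;
  arc_irr : irreflexive mg_arc;
  arc_asym : forall u v, mg_arc u v -> ~~ mg_arc v u;
  digon_arc : forall u v, mg_digon u v -> ~~ mg_arc u v }.

Section MixedGraph.
Variables (V : finType) (D : mixed_graph V).

(* Adjacency in the underlying simple graph. *)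
Definition adj : rel V := fun u v => [|| mg_digon D u v, mg_arc D u v | mg_arc D v u].

Definition Nout (x : V) : {set V} := [set v | mg_arc D x v].
Definition Nin (x : V) : {set V} := [set v | mg_arc D v x].
Definition Ndigon (x : V) : {set V} := [set v | mg_digon D x v].

(* A cycle of the underlying graph, listed in cyclic order. *)
Definition graph_cycle (c : seq V) : bool :=
  [&& 2 < size c, uniq c & cycle adj c]%N.

(* [traversal c w]: w = v_1, ..., v_l, v_1 goes once around the cycle c, from
   any starting vertex and in either direction. *)
Definition traversal (c w : seq V) : Prop :=
  exists v s, w = v :: rcons s v /\
    exists n, v :: s = rot n c \/ v :: s = rot n (rev c).

Section Weight.
Variables (R : realType) (alpha : complex R).

(* The value 0 for nonadjacent vertices is never used along a mixed walk. *)
Definition weight (u v : V) : complex R :=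
  if mg_digon D u v then 1
  else if mg_arc D u v then alpha
  else if mg_arc D v u then conjc alpha
  else 0.

(* [zip w (behead w)] lists the consecutive pairs of w. *)
Definition walk_value (w : seq V) : complex R :=
  \prod_(p <- zip w (behead w)) weight p.1 p.2.

Definition monograph1 : Prop :=
  forall c w, graph_cycle c -> traversal c w -> walk_value w = 1.

End Weight.

(* Each edge of a subgraph inherits its type (digon or arc) from D. *)
Record subgraph := Subgraph {
  sg_verts : {set V};
  sg_edge : rel V;
  sg_edge_sym : symmetric sg_edge;
  sg_edge_verts : forall u v, sg_edge u v -> u \in sg_verts;
  sg_edge_adj : forall u v, sg_edge u v -> adj u v }.

Definition sg_connected (U : subgraph) : Prop :=
  {in sg_verts U &, forall u v, connect (sg_edge U) u v}.

Definition sg_all_digons (U : subgraph) : Prop :=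
  forall u v, sg_edge U u v -> mg_digon D u v.

End MixedGraph.

(* [arc_extension D Vx D']: D' is obtained from D by adding the elements of M
   as new vertices (the [inr] part of V + M) and joining each x in M by arcs to
   exactly the vertices of [Vx x], all out of x or all into x. *)
Definition arc_extension (V M : finType) (D : mixed_graph V)
    (Vx : M -> {set V}) (D' : mixed_graph (V + M)%type) : Prop :=
  [/\ forall u v : V, mg_digon D' (inl u) (inl v) = mg_digon D u v,
      forall u v : V, mg_arc D' (inl u) (inl v) = mg_arc D u v,
      forall x : M, Ndigon D' (inr x) = set0
    & forall x : M,
        (Nout D' (inr x) = inl @: Vx x /\ Nin D' (inr x) = set0) \/
        (Nin D' (inr x) = inl @: Vx x /\ Nout D' (inr x) = set0)].

(* Main.v *)
(* For |alpha| = 1, a mixed graph is a monograph of first kind iff its weights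
   have the form phi v / phi u for a nowhere zero potential phi: V -> C.  The
   potential of D is constant on U, because digons have weight 1; hence it
   extends to each new vertex x by (its value on U) / alpha, or times alpha,
   according to the direction of the arcs at x. *)
Require Import Defs.
From mathcomp Require Import all_boot all_order all_algebra.
From mathcomp Require Import reals.
From mathcomp Require Import complex.
Local Open Scope ring_scope.

Set Implicit Arguments.
Unset Strict Implicit.
Unset Printing Implicit Defensive.

Import GRing.Theory Num.Theory.

Lemma not_uniq_split (T : eqType) (s : seq T) :
  ~~ uniq s -> exists y s1 s2 s3, s = s1 ++ y :: s2 ++ y :: s3.
Proof.
elim: s => [//|x s IHs] /=; rewrite negb_and negbK => /orP[xs|/IHs].
  by case/splitPr: xs => s2 s3; exists x, [::], s2, s3.
by case=> y [s1 [s2 [s3 ->]]]; exists y, (x :: s1), s2, s3.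
Qed.

Section Potential.
Variables (V : finType) (D : mixed_graph V) (R : realType) (alpha : complex R).

Lemma adj_sym : symmetric (adj D).
Proof. by move=> u v; rewrite /adj digon_sym [mg_arc D u v || _]orbC. Qed.

Lemma adj_irr : irreflexive (adj D).
Proof. by move=> u; rewrite /adj digon_irr arc_irr. Qed.

Lemma weight_mulC u v : `|alpha| = 1 -> adj D u v ->
  weight D alpha u v * weight D alpha v u = 1.
Proof.
move=> alpha1; have aJ : alpha * conjc alpha = 1.
  by rewrite -sqr_normc alpha1 expr1n.
rewrite /adj /weight (digon_sym D v u).
case: ifP => [_|_ /=]; first by rewrite mul1r.
case: ifP => [/arc_asym/negbTE-> //|_ /= ->].
by rewrite mulrC.
Qed.

Lemma walk_value1 x : walk_value D alpha [:: x] = 1.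
Proof. by rewrite /walk_value big_nil. Qed.

Lemma walk_value_cons x y p : walk_value D alpha [:: x, y & p] =
  weight D alpha x y * walk_value D alpha (y :: p).
Proof. by rewrite /walk_value /= big_cons. Qed.

Lemma walk_value_cat x p q : walk_value D alpha (x :: p ++ q) =
  walk_value D alpha (x :: p) * walk_value D alpha (last x p :: q).
Proof.
elim: p x => [|y p IHp] x; first by rewrite walk_value1 mul1r.
by rewrite cat_cons !walk_value_cons IHp mulrA.
Qed.

(* A repeated vertex splits a closed walk into two shorter closed walks; without
   repetition the walk is trivial, runs back and forth along one edge, or goes
   around a cycle. *)
Lemma closed_walk_value x p : `|alpha| = 1 -> monograph1 D alpha ->
  path (adj D) x p -> last x p = x -> walk_value D alpha (x :: p) = 1.
Proof.
move=> alpha1 monoD; have [n] := ubnP (size p).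
elim: n => // n IHn in x p * => szp xp lastp.
(* Testing [p] without its base point suffices: as [last x p = x], a nonempty [p] already lists
   [x]. *)
have [up|/not_uniq_split[y [p1 [p2 [p3 def_p]]]]] := boolP (uniq p).
  case: (lastP p) => [|q z] in szp xp lastp up *; first exact: walk_value1.
  rewrite last_rcons in lastp; subst z.
  case: q => [|y [|z q]] in szp xp up *.
  - by rewrite /= adj_irr in xp.
  - move: xp => /= /andP[xy _].
    by rewrite /= !walk_value_cons walk_value1 mulr1 weight_mulC.
  - apply: (monoD [:: x, y, z & q]); last first.
      by exists x, [:: y, z & q]; split=> //; exists 0%N; left; rewrite rot0.
    by rewrite /graph_cycle cons_uniq -rcons_uniq up.
move: szp xp lastp; rewrite {p}def_p cat_path /= cat_path /=.
rewrite !last_cat /= last_cat /= => szp /and5P[xp1 p1y yp2 p2y yp3] lastp.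
rewrite !size_cat /= size_cat /= !addnS ltnS in szp.
(* The walk is regrouped as [x] to [y] along [p1], the loop at [y] along [p2], and the rest [p3].
   The loop and the closed walk left after cutting it out are both shorter, so both have value 1. *)
rewrite -cat_rcons -(cat_rcons y p2) !walk_value_cat !last_rcons.
rewrite (IHn y (rcons p2 y)) ?rcons_path ?last_rcons ?yp2 //; last first.
  rewrite size_rcons; apply: leq_ltn_trans szp.
  by rewrite ltnS addnCA leq_addr.
rewrite mul1r; have := IHn x (rcons p1 y ++ p3).
rewrite walk_value_cat last_rcons; apply.
- rewrite size_cat size_rcons; apply: leq_ltn_trans szp.
  by rewrite addSn ltnS leq_add2l leq_addl.
- by rewrite cat_path rcons_path last_rcons xp1 p1y.
- by rewrite last_cat last_rcons.
Qed.

Definition potential (phi : V -> complex R) : Prop :=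
  (forall v, phi v != 0) /\
  (forall u v, adj D u v -> phi v = phi u * weight D alpha u v).

(** In each component, [phi v] is the value of some walk from a fixed root to [v]. Any choice of
    walks works, because closed walks have value 1. *)
Lemma monograph1_potential : `|alpha| = 1 -> monograph1 D alpha ->
  exists phi, potential phi.
Proof.
move=> alpha1 monoD.
have symD : connect_sym (adj D) by apply: sym_connect_sym; exact: adj_sym.
pose r := fingraph.root (adj D).
have /fin_all_exists[phi phiP] v : exists z : complex R, exists2 p,
    path (adj D) (r v) p /\ last (r v) p = v
  & z = walk_value D alpha (r v :: p).
  have /connectP[p rp lastp] : connect (adj D) (r v) v.
    by rewrite symD connect_root.
  by exists (walk_value D alpha (r v :: p)), p.
(* The value of a return walk to the root is an inverse of [phi v]; hence [phi v] is nonzero. *)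
have back v : exists2 q, path (adj D) v q /\ last v q = r v
    & phi v * walk_value D alpha (v :: q) = 1.
  have /connectP[q vq lastq] := connect_root (adj D) v.
  have [p [rp lastp] ->] := phiP v; exists q => //.
  rewrite -[in X in _ * X]lastp -walk_value_cat closed_walk_value //.
    by rewrite cat_path rp lastp.
  by rewrite last_cat lastp.
exists phi; split=> [v|u v uv].
  have [q _ vq1] := back v; apply/eqP => v0.
  by move/eqP: vq1; rewrite v0 mul0r eq_sym oner_eq0.
have [q [vq lastq] vq1] := back v; have [p [rp lastp] phiu] := phiP u.
have rE : r v = r u.
  by apply/esym/fingraph.rootP => //; apply: connect1.
(* Closing up through the edge from [u] to [v] shows that [phi u * weight D alpha u v] is inverse to
   the value of the same return walk as [phi v], so the two agree. *)
have: phi u * weight D alpha u v * walk_value D alpha (v :: q) = 1.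
  rewrite phiu -mulrA -walk_value_cons -[in X in _ * X]lastp -walk_value_cat.
  apply: closed_walk_value => //; first by rewrite cat_path rp lastp /= uv.
  by rewrite last_cat /= lastq rE.
rewrite -vq1 => /mulIf-> //; apply/eqP => q0.
by move/eqP: vq1; rewrite q0 mulr0 eq_sym oner_eq0.
Qed.

(** Along a walk the weights telescope to the quotient of [phi] at its two ends, which is 1 for a
    closed walk. *)
Lemma potential_monograph1 phi : potential phi -> monograph1 D alpha.
Proof.
case=> phi0 phiM c _ /and3P[_ _ cyc_c] [v [s [-> [n rotE]]]].
have cyc : cycle (adj D) (v :: s).
  case: rotE => ->; rewrite rot_cycle // rev_cycle.
  by rewrite -(eq_cycle adj_sym).
have walkE x p : path (adj D) x p ->
    phi (last x p) = phi x * walk_value D alpha (x :: p).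
  elim: p x => [|y p IHp] x /=; first by rewrite walk_value1 mulr1.
  by case/andP=> xy /IHp->; rewrite walk_value_cons mulrA -phiM.
have := walkE _ _ cyc; rewrite last_rcons -[LHS]mulr1.
by move/(mulfI (phi0 v)).
Qed.

Lemma potential_const_digons phi (U : subgraph D) :
  potential phi -> sg_connected U -> sg_all_digons U ->
  {in sg_verts U &, forall u v, phi u = phi v}.
Proof.
move=> [_ phiM] connU digU u v uU vU.
have /connectP[p up ->] := connU u v uU vU.
elim: p u up {uU} => //= y p IHp u /andP[uy /IHp <-].
by rewrite (phiM _ _ (sg_edge_adj uy)) /weight (digU _ _ uy) mulr1.
Qed.

End Potential.

Theorem theorem4p12 (R : realType) (alpha : complex R) (halpha : `|alpha| = 1)
    (V : finType) (D : mixed_graph V) (hD : monograph1 D alpha)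
    (U : subgraph D) (hUconn : sg_connected U) (hUdigons : sg_all_digons U)
    (M : finType) (Vx : M -> {set V})
    (hVx : forall x : M, Vx x \subset sg_verts U)
    (D' : mixed_graph (V + M)%type) (hD' : arc_extension D Vx D') :
  monograph1 D' alpha.
Proof.
have [phi potphi] := monograph1_potential halpha hD.
have constU := potential_const_digons potphi hUconn hUdigons.
have [phi0 phiM] := potphi.
have [digE arcE digM arcM] := hD'.
have digMF x w : mg_digon D' (inr x) w = false.
  by have /setP/(_ w) := digM x; rewrite !inE.
have noutE x w : mg_arc D' (inr x) w = (w \in Nout D' (inr x)).
  by rewrite inE.
have ninE x w : mg_arc D' w (inr x) = (w \in Nin D' (inr x)) by rewrite inE.
have adjMV x w : adj D' (inr x) w -> exists2 v, w = inl v & v \in Vx x.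
  rewrite /adj digMF noutE ninE /=.
  case: (arcM x) => -[-> ->]; rewrite in_set0 ?orbF /=;
    by case/imsetP=> v vx ->; exists v.
(* All arcs at [x] point the same way, so they carry the same weight as seen from [x]. *)
have weightM x u v : u \in Vx x -> v \in Vx x ->
    weight D' alpha (inr x) (inl u) = weight D' alpha (inr x) (inl v).
  move=> ux vx; rewrite /weight !digMF !noutE !ninE.
  by case: (arcM x) => -[-> ->]; rewrite !in_set0 !imset_f.
have /fin_all_exists[psi psiP] x : exists z : complex R, z != 0 /\
    forall v, adj D' (inr x) (inl v) ->
      phi v = z * weight D' alpha (inr x) (inl v).
  have [/existsP[u xu]|/existsPn noadj] :=
      boolP [exists u, adj D' (inr x) (inl u)]; last first.
    (* An isolated new vertex can take any nonzero value. *)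
    by exists 1; split=> [|v]; [exact: oner_neq0 | rewrite (negbTE (noadj v))].
  have w1 := weight_mulC halpha xu; have [_ [<-] ux] := adjMV _ _ xu.
  (* One neighbour [u] forces this value; it fits every other neighbour by [weightM] and because
     [phi] is constant on [U]. *)
  exists (phi u * weight D' alpha (inl u) (inr x)); split=> [|v xv].
    rewrite mulf_neq0 //; apply/eqP => w0.
    by move/eqP: w1; rewrite w0 mulr0 eq_sym oner_eq0.
  have [_ [<-] vx] := adjMV _ _ xv.
  rewrite (weightM _ _ _ vx ux) -mulrA (mulrC (weight _ _ _ _)) w1 mulr1.
  by apply: constU; apply: (subsetP (hVx x)).
pose phi' w := match w with inl v => phi v | inr x => psi x end.
apply: (@potential_monograph1 _ _ _ _ phi'); split=> [[v|x]|[u|x] [v|y]] //=.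
- by have [] := psiP x.
- move=> uv; rewrite /weight !digE !arcE; apply: phiM.
  by rewrite /adj digE !arcE in uv *.
(* [psiP] treats edges leaving the new vertex; the reverse direction follows since opposite weights
   are inverse. *)
- rewrite adj_sym => yu; have [_ ->] := psiP y; last exact: yu.
  by rewrite -mulrA weight_mulC // mulr1.
- by move=> xv; have [_ ->] := psiP x.
- by case/adjMV.
Qed.
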